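(* Let $p>5$ be a prime, let $(G,T)$ be a two-generated group of $GM(p)$-type, let $\eta=-\frac{1}{p-2}$, let $\mathbb{F}$ be a field of good characteristic relative to $(p,\eta)$, and let $A=A_{\mathbb{F}}(G,T,\eta)$. Then every idempotent in $T$ is a left axis of $\mathcal{GM}(\lambda,-\lambda)$-type in $A$, where $\lambda=1-\eta$.
   Context: Groups. A pair $(G,T)$ is a faithful odd transposition group if $G$ is a periodic group, $T$ is a normal (conjugation-invariant) subset of involutions of $G$ with $\langle T\rangle=G$, and $|ab|$ is odd for any $a,b\in T$. It is of $GM(p)$-type if $|ab|=p$ for any two distinct $a,b\in T$. It is two-generated if $G=\langle a,b\rangle$ for some distinct $a,b\in T$ (so $G$ is dihedral of order $2p$ and $T=I(a,b)$). Write $a^b=b^{-1}ab$, and let $I(a,b)$ be the set of all involutions of $\langle a,b\rangle$. Algebra. Fields have characteristic not $2$; algebras are not assumed associative or commutative. $A_{\mathbb{F}}(G,T,\eta)$ (for $\eta\in\mathbb{F}\setminus\{0,1\}$) is the $\mathbb{F}$-algebra with basis $T$ and bilinear product $a*a=a$, and $a*b=b^a+\eta\sum_{x\in I(a,b)\setminus\{b^a\}}x$ for $a\ne b$ in $T$. The field $\mathbb{F}$ has good characteristic relative to $(p,\eta)$ if $1,\ \eta(p-2)+1,\ \eta-1,\ 1-\eta$ are distinct in $\mathbb{F}$. Axes. A fusion law is a finite set $\mathcal{F}\subseteq\mathbb{F}$ with a map $\circ:\mathcal{F}\times\mathcal{F}\to 2^{\mathcal{F}}$. For an idempotent $a$ let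 $L_a(x)=a*x$, $R_a(x)=x*a$, $A_\lambda(L_a)=\{v:a*v=\lambda v\}$ (similarly for $R_a$), and $A_\Omega(L_a)=\bigoplus_{\lambda\in\Omega}A_\lambda(L_a)$. The idempotent $a$ is primitive if $\dim A_1(L_a)=\dim A_1(R_a)=1$. A left $(\mathcal{F},\circ)$-axis is a primitive idempotent $a$ with $A=A_{\mathcal{F}}(L_a)$ (so $L_a$ is semisimple) such that $x*y\in A_{\alpha\circ\beta}(L_a)$ for all $\alpha,\beta\in\mathcal{F}$, $x\in A_\alpha(L_a)$, $y\in A_\beta(L_a)$. The generalized Monster type fusion law $\mathcal{GM}(\alpha,\beta)$ is the symmetric law on $\{1,0,\alpha,\beta\}$ given by $1\circ1=\{1\}$, $1\circ0=\varnothing$, $1\circ\alpha=\{\alpha\}$, $1\circ\beta=\{\beta\}$, $0\circ0=\{0,1\}$, $0\circ\alpha=\{\alpha\}$, $0\circ\beta=\{\beta\}$, $\alpha\circ\alpha=\{1,0,\alpha\}$, $\alpha\circ\beta=\{\beta\}$, $\beta\circ\beta=\{1,0,\alpha\}$.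
   Formalization: The condition dim A_1(R_a)=1 in ''primitive'' is claimed only if λ^m≠1, m the order of 2 mod p, since it fails when λ^m=1 (e.g. p=7, F=F_13, η=5, λ=9); all other parts of being a left axis of GM(λ,-λ)-type are claimed without this condition. *)

(* Defs.v *)
From HB Require Import structures.
From mathcomp Require Import all_boot all_order all_fingroup all_algebra finmap.

Set Implicit Arguments.
Unset Strict Implicit.
Unset Printing Implicit Defensive.

Import GRing.Theory.
Local Open Scope ring_scope.

Section Groups.
Local Open Scope group_scope.
Variable gT : finGroupType.
Implicit Types (G : {group gT}) (T : {set gT}) (a b : gT).

(* Periodicity of G needs no clause: G is finite. *)
Definition odd_transposition_group G T : Prop :=
  [/\ {in T, forall t, #[t] = 2%N},
      T \subset G,
      {in T & G, forall t g, t ^ g \in T},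
      <<T>> = G
    & {in T &, forall a b, odd #[a * b]}].

Definition GM_group (p : nat) G T : Prop :=
  odd_transposition_group G T
  /\ {in T &, forall a b, a != b -> #[a * b] = p}.

Definition two_generated G T : Prop :=
  exists a b, [/\ a \in T, b \in T, a != b & <<[set a; b]>> = G].

(* I(a, b) *)
Definition invols a b : {set gT} := [set x in <<[set a; b]>> | #[x] == 2%N].

End Groups.

(* Not necessarily associative, commutative or unital algebras, finite
   dimensional over a field. *)
Record algebra (F : fieldType) := Algebra {
  alg_sort :> vectType F;
  alg_mul : alg_sort -> alg_sort -> alg_sort;
  alg_mul_linearl : forall x, linear (alg_mul x);
  alg_mul_linearr : forall y, linear (alg_mul^~ y) }.

Section Multiplications.
Variables (F : fieldType) (A : algebra F) (a : A).

Definition lmul (x : A) : A := alg_mul a x.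
Definition rmul (x : A) : A := alg_mul x a.

HB.instance Definition _ :=
  GRing.isLinear.Build F A A _ lmul (alg_mul_linearl a).
HB.instance Definition _ :=
  GRing.isLinear.Build F A A _ rmul (alg_mul_linearr a).

Definition L_ : 'End(A) := linfun lmul.
Definition R_ : 'End(A) := linfun rmul.

Lemma L_E x : L_ x = alg_mul a x. Proof. by rewrite lfunE. Qed.
Lemma R_E x : R_ x = alg_mul x a. Proof. by rewrite lfunE. Qed.

End Multiplications.

Record fusion_law (F : fieldType) := FusionLaw {
  fl_set : {fset F};
  fl_op : F -> F -> {fset F};
  fl_closed : forall x y, x \in fl_set -> y \in fl_set ->
                (fl_op x y `<=` fl_set)%fset }.

(* A_Omega(f); the sum is automatically direct, because the eigenvalues in the
   set Omega are pairwise distinct. *)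
Definition eigensum (F : fieldType) (V : vectType F) (f : 'End(V))
    (Omega : {fset F}) : {vspace V} :=
  (\sum_(mu <- Omega) passmx.leigenspace f mu)%VS.

Section Axes.
Variables (F : fieldType) (A : algebra F).
Implicit Types (a : A) (law : fusion_law F).

Definition idempotent_elt a : Prop := alg_mul a a = a.

Definition left_primitive a : Prop := \dim (passmx.leigenspace (L_ a) 1) = 1%N.
Definition right_primitive a : Prop := \dim (passmx.leigenspace (R_ a) 1) = 1%N.
Definition primitive a : Prop := left_primitive a /\ right_primitive a.

Definition obeys_left_fusion law a : Prop :=
  eigensum (L_ a) (fl_set law) = fullv
  /\ forall alpha beta : F, alpha \in fl_set law -> beta \in fl_set law ->
     forall x y : A, x \in passmx.leigenspace (L_ a) alpha ->
       y \in passmx.leigenspace (L_ a) beta ->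
       alg_mul x y \in eigensum (L_ a) (fl_op law alpha beta).

Definition left_axis law a : Prop :=
  [/\ idempotent_elt a, primitive a & obeys_left_fusion law a].

(* Same as left_axis, without the condition on the 1-eigenspace of R_ a, which
   can fail for the algebras below over some fields of positive characteristic:
   there R_ a acts on the combinations of T \ {a} with coefficient sum 0 as
   1 - eta times a permutation of T \ {a}, all of whose cycles have length the
   order of 2 modulo p. *)
Definition left_primitive_left_axis law a : Prop :=
  [/\ idempotent_elt a, left_primitive a & obeys_left_fusion law a].

End Axes.

Section GeneralizedMonster.
Variables (F : fieldType) (al be : F).
Local Open Scope fset_scope.

(* The symmetric table; it is meant for 1, 0, al, be pairwise distinct. *)
Definition GM_op (x y : F) : {fset F} :=
  let on u v := ((x, y) == (u, v)) || ((x, y) == (v, u)) in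
  if on 1 1 then [fset 1]
  else if on 1 0 then fset0
  else if on 1 al then [fset al]
  else if on 1 be then [fset be]
  else if on 0 0 then [fset 0; 1]
  else if on 0 al then [fset al]
  else if on 0 be then [fset be]
  else if on al al then [fset 1; 0; al]
  else if on al be then [fset be]
  else if on be be then [fset 1; 0; al]
  else fset0.

Lemma GM_closed x y : x \in [fset 1; 0; al; be] -> y \in [fset 1; 0; al; be] ->
  GM_op x y `<=` [fset 1; 0; al; be].
Proof.
move=> _ _; rewrite /GM_op.
by do 10?[case: ifP => _];
  rewrite ?fsub0set ?fsubUset ?fsub1set ?inE ?eqxx ?orbT.
Qed.

Definition GM_law : fusion_law F := FusionLaw GM_closed.

End GeneralizedMonster.

Section GMAlgebra.
Variables (F : fieldType) (gT : finGroupType) (T : {set gT}) (eta : F).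

(* The vector space with basis T. *)
Definition GM_space : vectType F := {ffun {x : gT | x \in T} -> F^o}.

(* The basis vector attached to x when x is in T (0 otherwise). *)
Definition basis_vec (x : gT) : GM_space := [ffun t => (val t == x)%:R].

Definition basis_mul (a b : gT) : GM_space :=
  if a == b then basis_vec a
  else basis_vec (b ^ a)%g
       + eta *: \sum_(x in invols a b :\ (b ^ a)%g) basis_vec x.

Definition GM_mul (u v : GM_space) : GM_space :=
  \sum_a \sum_b (u a * v b) *: basis_mul (val a) (val b).

Lemma GM_mul_linearl u : linear (GM_mul u).
Proof.
move=> c v w; rewrite /GM_mul scaler_sumr -big_split; apply: eq_bigr => a _ /=.
rewrite scaler_sumr -big_split; apply: eq_bigr => b _ /=.
by rewrite !ffunE mulrDr scalerDl scalerA mulrCA.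
Qed.

Lemma GM_mul_linearr v : linear (GM_mul^~ v).
Proof.
move=> c u w; rewrite /GM_mul scaler_sumr -big_split; apply: eq_bigr => a _ /=.
rewrite scaler_sumr -big_split; apply: eq_bigr => b _ /=.
by rewrite !ffunE mulrDl scalerDl scalerA -mulrA.
Qed.

Definition GM_algebra : algebra F := Algebra GM_mul_linearl GM_mul_linearr.

End GMAlgebra.

Definition good_characteristic (F : fieldType) (p : nat) (eta : F) : bool :=
  uniq [:: 1; eta * (p%:R - 2%:R) + 1; eta - 1; 1 - eta].

(* Main.v *)
Require Import Defs.
From mathcomp Require Import all_boot all_order all_fingroup all_algebra finmap.
From mathcomp Require Import ring.
Import GRing.Theory.
Local Open Scope ring_scope.
Set Implicit Arguments.
Unset Strict Implicit.
Unset Printing Implicit Defensive.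

(** The subgroup generated by two distinct involutions of T is dihedral of order
2p and its involutions are the p conjugates of either generator, so that T is
the set of all involutions of G, it has p elements, and I(a, b) = T for all
a <> b in T. The product of two vectors u and v then has a closed form: writing
lambda = 1 - eta, S for the sum of T, and c(u) for the sum of the coefficients
of u,
  u * v = lambda sum_(a, b) u_a v_b (b ^ a)
            + eta (c(u) c(v) - sum_a u_a v_a) S + eta sum_a u_a v_a a
(GM_mulE). Everything is read off this formula, one coordinate at a time.

Fix an axis a and let tau be conjugation by a, which is an involutive
automorphism of the algebra (tauM). By the formula,
  a * v = lambda (tau v) + eta (c(v) - v_a) S + eta v_a a.
Since eta (p - 2) = -1, summing the coordinates of a * v = mu v other than the
one at a gives mu (c(v) - v_a) = 0 (eigen_coords). This determines the
eigenspaces: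
- for 1, the line spanned by a;
- for 0, the line spanned by z = S - eta a;
- for lambda, the tau-invariant vectors v with v_a = 0 and c(v) = 0;
- for -lambda, the tau-antiinvariant vectors.
The tau-invariant vectors are exactly the sum of the first three spaces
(memv_sym), and so L_a is diagonalisable.

The fusion rules between lambda and -lambda only say that tau is an
automorphism. The remaining rules involve multiplication by a or z on either
side: S acts as the scalar eta on vectors with zero coefficient sum, because
both b |-> b ^ a and a |-> b ^ a permute T (the latter as p is odd), and right
multiplication by a commutes with tau and preserves the conditions that define
the eigenspaces.

A vector fixed by right multiplication by a has c(v) = v_a and satisfies
v_(a ^ t) = lambda v_t for t <> a. In the cyclic group of rotations t |-> a ^ t
is doubling, and its m-th iterate is the identity when m is the order of 2
modulo p. Hence v_t = lambda ^ m v_t, and v is a multiple of a when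
lambda ^ m <> 1 (right_eigen1). *)

(** * Eigenspaces and the fusion table *)

Section Eigensums.
Variables (F : fieldType) (V : vectType F) (f : 'End(V)).
Implicit Types (mu : F) (Omega : {fset F}) (v : V).

Lemma memv_leigenspace mu v : (v \in passmx.leigenspace f mu) = (f v == mu *: v).
Proof. by rewrite memv_ker add_lfunE opp_lfunE scale_lfunE id_lfunE subr_eq0. Qed.

Lemma memv_eigensum mu Omega v : mu \in Omega ->
  v \in passmx.leigenspace f mu -> v \in eigensum f Omega.
Proof.
by move=> mu_in; apply: subvP; rewrite /eigensum (big_rem mu) //= addvSl.
Qed.

End Eigensums.

(** The nested tests that define the table resolve once the four eigenvalues are
distinct; these equations and symmetry give all sixteen entries. *)
Lemma GM_opE (F : fieldType) (al be : F) : uniq [:: 1; 0; al; be] ->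
  let op := GM_op al be in
  [/\ [/\ op 1 1 = [fset 1], op 1 0 = fset0, op 1 al = [fset al] & op 1 be = [fset be]],
      [/\ op 0 0 = [fset 0; 1], op 0 al = [fset al] & op 0 be = [fset be]],
      [/\ op al al = [fset 1; 0; al], op al be = [fset be] & op be be = [fset 1; 0; al]]
    & forall x y, op x y = op y x]%fset.
Proof.
rewrite /= !inE !negb_or => /and4P[/and3P[n10 n1a n1b] /andP[n0a n0b] nab _].
have E := (negPf n10, negPf n1a, negPf n1b, negPf n0a, negPf n0b, negPf nab).
have E' := (eq_sym 0 (1 : F), eq_sym al 1, eq_sym be 1, eq_sym al 0, eq_sym be 0,
  eq_sym be al).
split.
- by rewrite /GM_op !xpair_eqE !eqxx !E' !E.
- by rewrite /GM_op !xpair_eqE !eqxx !E' !E.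
- by rewrite /GM_op !xpair_eqE !eqxx !E' !E.
move=> x y.
have on_sym u v : ((y, x) == (u, v)) || ((y, x) == (v, u))
    = ((x, y) == (u, v)) || ((x, y) == (v, u)).
  by rewrite !xpair_eqE orbC andbC [(y == u) && _]andbC.
by rewrite /GM_op !on_sym.
Qed.

(** * Pairs of involutions with product of odd order *)

Section OddTranspositions.
Local Open Scope group_scope.
Variable gT : finGroupType.
Implicit Types (a b c r t u v x y : gT).

Lemma invol_mulK a : #[a] = 2 -> a * a = 1.
Proof. by move=> oa; rewrite -{1}(invg2id oa) mulVg. Qed.

Lemma invol_rotJ a b : #[a] = 2 -> #[b] = 2 -> (a * b) ^ a = (a * b)^-1.
Proof.
move=> oa ob; rewrite conjgE invMg (invg2id ob) (invg2id oa).
by rewrite !mulgA invol_mulK // mul1g.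
Qed.

(** Both elements are powers of their squares with the same exponent, half of
the even number #[x] * #[y] + 1. *)
Lemma sqrg_odd_inj x y : odd #[x] -> odd #[y] -> x ^+ 2 = y ^+ 2 -> x = y.
Proof.
move=> ox oy e; pose m := (#[x] * #[y])%N.
have om : odd m by rewrite oddM ox.
have sqrtE (z : gT) : z ^+ m = 1 -> (z ^+ 2) ^+ (m.+1./2) = z.
  by move=> z1; rewrite -expgM mul2n even_halfK /= ?om // expgS z1 mulg1.
rewrite -[LHS]sqrtE; last by rewrite /m expgM expg_order expg1n.
by rewrite e sqrtE // /m mulnC expgM expg_order expg1n.
Qed.

Lemma rot_involJ a b v : #[a] = 2 -> #[b] = 2 -> v \in <[a * b]> -> v ^ a = v^-1.
Proof. by move=> oa ob /cycleP[n ->]; rewrite conjXg invol_rotJ // expgVn. Qed.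

(** The involution a inverts the rotation v, so v^-1 a v = a v v. *)
Lemma involJ_rot a b v : #[a] = 2 -> #[b] = 2 -> v \in <[a * b]> ->
  a ^ v = a * v ^+ 2.
Proof.
move=> oa ob vr; rewrite conjgE -(rot_involJ oa ob vr) conjgE invg2id //.
by rewrite -!mulgA [a * (a * _)]mulgA invol_mulK // mul1g.
Qed.

Lemma odd_order_cycle r v : odd #[r] -> v \in <[r]> -> odd #[v].
Proof.
move=> or; rewrite -cycle_subG => /cardSg dvd_vr.
exact: dvdn_odd dvd_vr or.
Qed.

Lemma gen_invol2 a b : #[a] = 2 -> #[b] = 2 ->
  <<[set a; b]>> = <[a]> * <[a * b]>.
Proof.
move=> oa ob; set r := a * b.
have nr : <[a]> \subset 'N(<[r]>).
  by rewrite norms_cycle (rot_involJ oa ob) ?groupV ?cycle_id.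
rewrite -norm_joinEl //; apply/eqP; rewrite eqEsubset; apply/andP; split.
  have bE : b = a * r by rewrite /r mulgA invol_mulK // mul1g.
  have aJ : a \in <[a]> <*> <[r]> by rewrite (subsetP (joing_subl _ _)) ?cycle_id.
  have rJ : r \in <[a]> <*> <[r]> by rewrite (subsetP (joing_subr _ _)) ?cycle_id.
  by rewrite gen_subG subUset !sub1set aJ bE groupM.
by rewrite join_subG !cycle_subG groupM ?mem_gen // !inE eqxx ?orbT.
Qed.

(** An element of the dihedral group is a rotation, hence of odd order, or of
the form a * v with v a rotation; then v has a square root w among the rotations,
and a * w ^+ 2 is the conjugate of a by w. *)
Lemma invols_odd a b : #[a] = 2 -> #[b] = 2 -> odd #[a * b] ->
  invols a b = [set a ^ v | v in <[a * b]>].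
Proof.
move=> oa ob or; apply/setP=> x; rewrite inE gen_invol2 //.
apply/andP/imsetP=> [[]|[v vr ->]]; last first.
  by rewrite orderJ oa (involJ_rot oa ob vr) mem_mulg ?cycle_id ?groupX.
case/mulsgP=> u v; rewrite cycle2g // !inE => /orP[]/eqP-> vr -> /eqP ox.
  by have := odd_order_cycle or vr; rewrite -[v]mul1g ox.
exists (v ^+ (#[v].+1)./2); first exact: groupX.
rewrite (involJ_rot oa ob) ?groupX // -expgM muln2.
rewrite even_halfK /= ?(odd_order_cycle or vr) //.
by rewrite expgS expg_order mulg1.
Qed.

Lemma card_invols_odd a b : #[a] = 2 -> #[b] = 2 -> odd #[a * b] ->
  #|invols a b| = #[a * b].
Proof.
move=> oa ob or; rewrite invols_odd // card_in_imset // => u v ur vr.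
rewrite !(involJ_rot oa ob) // => /mulgI; apply: sqrg_odd_inj.
  exact: odd_order_cycle or ur.
exact: odd_order_cycle or vr.
Qed.

(** The conjugate a ^ b determines a * a ^ b = (a * b) ^+ 2, hence a * b. *)
Lemma conjg_invol_inj a b c : #[a] = 2 -> #[b] = 2 -> #[c] = 2 ->
  odd #[a * b] -> odd #[a * c] -> a ^ b = a ^ c -> b = c.
Proof.
move=> oa ob oc oab oac e; apply: (mulgI a); apply: sqrg_odd_inj => //.
by move: e; rewrite !conjgE !invg2id // !expgS !expg0 !mulg1 -!mulgA => ->.
Qed.

(** Measured by the rotation a * t, conjugating a by t doubles the angle between
a and t. *)
Lemma iter_conj_invol a t k : #[a] = 2 -> #[t] = 2 ->
  a * iter k (conjg a) t = (a * t) ^+ (2 ^ k).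
Proof.
move=> oa ot.
have doubling s : #[s] = 2 -> a * a ^ s = (a * s) ^+ 2.
  by move=> os; rewrite conjgE invg2id // expgS expg1 !mulgA.
elim: k => [|k IH] /=; first by rewrite expg1.
rewrite doubling; first by rewrite IH expnSr expgM.
by case: k {IH} => [|k] //=; rewrite orderJ.
Qed.

Section GMGroups.
Variables (p : nat) (G : {group gT}) (T : {set gT}).
Hypotheses (GT : GM_group p G T) (G2 : two_generated G T).

(** The class of a under <[a * b]> has p elements and lies in T, and it is all
of invols a b. For a generating pair invols a b also contains T, so #|T| = p; by
cardinality the inclusion is then an equality for every pair. *)
Lemma GM_invols : {in T &, forall a b, a != b -> invols a b = T} /\ #|T| = p.
Proof.
have [[T2 TG TJ _ Todd] Tp] := GT.
have iT : {in T &, forall a b, a != b -> invols a b \subset T}.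
  move=> a b aT bT ab; rewrite invols_odd; [|exact: T2|exact: T2|exact: Todd].
  apply/subsetP=> _ /imsetP[v vr ->]; apply: TJ => //.
  by apply: subsetP vr; rewrite cycle_subG groupM //; exact: (subsetP TG).
have cT : {in T &, forall a b, a != b -> #|invols a b| = p}.
  move=> a b aT bT ab; rewrite card_invols_odd; first exact: Tp.
  - exact: T2.
  - exact: T2.
  exact: Todd.
have [a [b [aT bT ab gab]]] := G2.
have TE : T = invols a b.
  apply/eqP; rewrite eqEsubset iT // andbT; apply/subsetP=> t tT.
  by rewrite inE gab (subsetP TG) ?T2.
have oT : #|T| = p by rewrite TE cT.
split=> // c d cT' dT cd; apply/eqP.
by rewrite eqEcard iT // oT cT /=.
Qed.

End GMGroups.

End OddTranspositions.

(** * The product in coordinates *)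

Section Coordinates.
Variables (gT : finGroupType) (T : {set gT}).
Local Notation I := {x : gT | x \in T}.
Implicit Types (s t a b : I).

(** The default value of insubd is never reached when T is closed under
conjugation. *)
Definition conjT (s t : I) : I := insubd s (val s ^ val t)%g.

Hypothesis T2 : {in T, forall t : gT, #[t]%g = 2%N}.
Hypothesis TJ : {in T &, forall s t : gT, (s ^ t)%g \in T}.
Hypothesis Todd : {in T &, forall s t : gT, odd #[s * t]%g}.
Hypothesis TI : {in T &, forall a b : gT, a != b -> invols a b = T}.

Lemma val_conjT s t : val (conjT s t) = (val s ^ val t)%g.
Proof. by rewrite insubdK //; apply: TJ; apply: valP. Qed.

Lemma conjTK t : involutive (conjT^~ t).
Proof.
move=> s; apply: val_inj; rewrite !val_conjT -conjgM.
by rewrite invol_mulK ?conjg1 // T2 ?(valP t).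
Qed.

Lemma conjTid t : conjT t t = t.
Proof. by apply: val_inj; rewrite val_conjT conjgE mulKg. Qed.

Lemma conjTJ s t a : conjT (conjT s t) a = conjT (conjT s a) (conjT t a).
Proof. by apply: val_inj; rewrite !val_conjT conjJg. Qed.

Lemma conjT_injr s : injective (conjT s).
Proof.
move=> a b /(congr1 val); rewrite !val_conjT => e; apply: val_inj.
by apply: conjg_invol_inj e; do ?[exact: T2 (valP _) | exact: Todd (valP _) (valP _)].
Qed.

Lemma conjT_eql a t : (conjT a t == a) = (t == a).
Proof. by rewrite -{2}(conjTid a) (inj_eq (@conjT_injr a)). Qed.

Lemma conjT_eqr a t : (conjT t a == a) = (t == a).
Proof. by rewrite (can2_eq (conjTK a) (conjTK a)) conjTid. Qed.

(** The angle of t is multiplied by 2 ^ m, which is 1 modulo p. *)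
Lemma iter_conjT_id p a t m : prime p -> #|T| = p ->
  m.-primitive_root (2%:R : 'F_p) -> iter m (conjT a) t = t.
Proof.
move=> pr_p oT rt; apply: val_inj.
have -> : val (iter m (conjT a) t) = iter m (conjg (val a)) (val t).
  by elim: m {rt} => [|m IH] //; rewrite !iterS val_conjT IH.
apply: (mulgI (val a)); rewrite iter_conj_invol ?T2 ?(valP a) ?(valP t) //.
have [->|nat_] := eqVneq a t.
  by rewrite invol_mulK ?T2 ?(valP t) // expg1n.
have o : #[val a * val t]%g = p.
  rewrite -card_invols_odd; first by rewrite TI ?(valP a) ?(valP t).
  - exact: T2 (valP a).
  - exact: T2 (valP t).
  exact: Todd (valP a) (valP t).
rewrite -expg_mod_order -[RHS]expg1 -[in RHS]expg_mod_order o; congr (_ ^+ _)%g.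
by rewrite -!val_Fp_nat // natrX (prim_expr_order rt).
Qed.

Variables (F : fieldType) (eta : F).
Local Notation V := (GM_space F T).
Local Notation mul := (@GM_mul F gT T eta).
Local Notation lam := (1 - eta).
Implicit Types (u v w : V).

Definition csum (v : V) : F := \sum_t v t.

Lemma coordP (u v : V) : (forall t, u t = v t :> F) -> u = v.
Proof. by move=> uv; apply/ffunP. Qed.

Lemma coordZ c v t : (c *: v) t = c * v t :> F. Proof. by rewrite ffunE. Qed.
Lemma coordD u v t : (u + v) t = u t + v t :> F. Proof. by rewrite ffunE. Qed.
Lemma coordN v t : (- v) t = - v t :> F. Proof. by rewrite ffunE. Qed.

(** A single formula for the product of two basis vectors: in the case a = b the
uniform term lam [t = a] has to be completed by eta [t = a]. *)
Lemma basis_mulE a b t : basis_mul T eta (val a) (val b) t =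
  lam * (t == conjT b a)%:R + eta * (a != b)%:R + eta * ((a == b) && (t == a))%:R.
Proof.
rewrite /basis_mul val_eqE; have [->|nab] := eqVneq a b.
  rewrite !ffunE conjTid val_eqE /= mulr0 addr0.
  by rewrite -mulrDl subrK mul1r.
rewrite !ffunE -val_conjT val_eqE sum_ffunE.
rewrite TI ?(valP a) ?(valP b) ?val_eqE //.
rewrite (eq_bigr (fun x => (val t == x)%:R)); last by move=> x _; rewrite ffunE.
rewrite /= mulr0 addr0 mulr1.
have [->|ntb] := eqVneq t (conjT b a).
  rewrite big1 ?scaler0 ?addr0; first by rewrite mulr1 subrK.
  by move=> x; rewrite !inE => /andP[/negPf+ _]; rewrite eq_sym => ->.
rewrite (bigD1 (val t)) /=; last by rewrite !inE val_eqE ntb (valP t).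
rewrite eqxx big1 ?addr0 ?mulr0 ?add0r; first by rewrite /GRing.scale /= mulr1.
by move=> x /andP[_ /negPf]; rewrite eq_sym => ->.
Qed.

Lemma sum_deltar (f : I -> F) t : \sum_s f s * (s == t)%:R = f t.
Proof.
rewrite (bigD1 t) //= eqxx mulr1 big1 ?addr0 // => s /negPf->.
by rewrite mulr0.
Qed.

Lemma sum_deltal (f : I -> F) t : \sum_s (s == t)%:R * f s = f t.
Proof. by rewrite -[RHS]sum_deltar; apply: eq_bigr => s _; rewrite mulrC. Qed.

(** Bilinear extension of basis_mulE: the vector b ^ a contributes at t exactly
when b = t ^ a. *)
Lemma GM_mulE (u v : V) t : mul u v t =
  lam * (\sum_s u s * v (conjT t s)) + eta * (csum u * csum v - \sum_s u s * v s)
  + eta * (u t * v t).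
Proof.
rewrite /GM_mul sum_ffunE.
transitivity (\sum_s (lam * (u s * v (conjT t s))
   + eta * (u s * csum v - u s * v s) + (s == t)%:R * (eta * (u t * v t)))).
  apply: eq_bigr => a _; rewrite sum_ffunE.
  transitivity (\sum_b (lam * (u a * (v b * (b == conjT t a)%:R))
      + eta * (u a * v b - u a * (v b * (b == a)%:R))
      + (a == t)%:R * (eta * (u t * (v b * (b == t)%:R))))).
    apply: eq_bigr => b _; rewrite ffunE basis_mulE /GRing.scale /=.
    have -> : (t == conjT b a) = (b == conjT t a).
      by rewrite eq_sym (can2_eq (conjTK a) (conjTK a)).
    rewrite [a == t]eq_sym [b == a]eq_sym.
    by have [->|_] := eqVneq t a; have [<-|_] := eqVneq a b; rewrite /= ?andbF; ring.
  by rewrite !big_split /= -!mulr_sumr sumrB -!mulr_sumr !sum_deltar.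
by rewrite !big_split /= -!mulr_sumr sumrB -mulr_suml sum_deltal.
Qed.

Lemma csum_conjl (v : V) s : \sum_t v (conjT t s) = csum v.
Proof. by rewrite [RHS](reindex_inj (inv_inj (conjTK s))). Qed.

(** Here the oddness of the orders is needed: it makes s |-> t ^ s a bijection. *)
Lemma csum_conjr (v : V) t : \sum_s v (conjT t s) = csum v.
Proof. by rewrite [RHS](reindex_inj (@conjT_injr t)). Qed.

Lemma csumD u v : csum (u + v) = csum u + csum v.
Proof. by rewrite /csum -big_split; apply: eq_bigr => t _; rewrite ffunE. Qed.

Lemma csumZ c (v : V) : csum (c *: v) = c * csum v.
Proof. by rewrite /csum mulr_sumr; apply: eq_bigr => t _; rewrite ffunE. Qed.

Lemma GM_mulDr (u v w : V) : mul u (v + w) = mul u v + mul u w.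
Proof. by rewrite -[v]scale1r GM_mul_linearl !scale1r. Qed.

Lemma GM_mulDl (u v w : V) : mul (u + v) w = mul u w + mul v w.
Proof. by have := GM_mul_linearr eta w 1 u v; rewrite !scale1r. Qed.

Lemma GM_mulr0 (u : V) : mul u 0 = 0.
Proof. by apply: (@addrI _ (mul u 0)); rewrite -GM_mulDr !addr0. Qed.

Lemma GM_mul0r (u : V) : mul 0 u = 0.
Proof. by apply: (@addrI _ (mul 0 u)); rewrite -GM_mulDl !addr0. Qed.

Lemma GM_mulZr c (u v : V) : mul u (c *: v) = c *: mul u v.
Proof. by have := GM_mul_linearl eta u c v 0; rewrite GM_mulr0 !addr0. Qed.

Lemma GM_mulZl c (u v : V) : mul (c *: u) v = c *: mul u v.
Proof. by have := GM_mul_linearr eta v c u 0; rewrite /= GM_mul0r !addr0. Qed.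

Lemma cardI : #|{: I}| = #|T|.
Proof. by rewrite card_sig; apply: eq_card. Qed.

Lemma csum_mul (u v : V) : csum (mul u v) =
  lam * (csum u * csum v) + #|T|%:R * (eta * (csum u * csum v - \sum_s u s * v s))
  + eta * \sum_s u s * v s.
Proof.
rewrite /csum (eq_bigr _ (fun t _ => GM_mulE u v t)) !big_split /= -!mulr_sumr.
rewrite exchange_big /= (eq_bigr (fun s => u s * csum v)); last first.
  by move=> s _; rewrite -mulr_sumr csum_conjl.
by rewrite -mulr_suml sumr_const cardI -[_ *+ #|T|]mulr_natl [_ * (#|T|%:R * _)]mulrCA.
Qed.

Definition ones : V := [ffun => 1 : F].

Lemma onesE t : ones t = 1 :> F. Proof. by rewrite ffunE. Qed.

Lemma csum_ones : csum ones = #|T|%:R.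
Proof.
by rewrite /csum (eq_bigr (fun=> 1)) ?sumr_const ?cardI // => t; rewrite ffunE.
Qed.

Lemma sum_ones_mull (f : I -> F) : \sum_s ones s * f s = \sum_s f s.
Proof. by apply: eq_bigr => s _; rewrite ffunE mul1r. Qed.

(** With mul_onesr: the sum of all basis vectors acts as the scalar eta on the
vectors with zero coefficient sum. *)
Lemma mul_onesl (v : V) : csum v = 0 -> mul ones v = eta *: v.
Proof.
move=> v0; apply: coordP => t; rewrite GM_mulE [RHS]ffunE v0.
rewrite (sum_ones_mull v) (sum_ones_mull (fun s => v (conjT t s))).
rewrite csum_conjr v0 -/(csum v) v0.
by rewrite ffunE !(mulr0, subrr, add0r) mul1r.
Qed.

Lemma mul_onesr (v : V) : csum v = 0 -> mul v ones = eta *: v.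
Proof.
move=> v0; apply: coordP => t; rewrite GM_mulE [RHS]ffunE v0.
have vE (f : I -> F) : (forall s, f s = 1) -> \sum_s v s * f s = 0.
  by move=> f1; rewrite -[RHS]v0; apply: eq_bigr => s _; rewrite f1 mulr1.
rewrite !vE => [|s|s]; rewrite ?ffunE //.
by rewrite !(mulr0, mul0r, subrr, add0r) mulr1.
Qed.

Lemma mul_ones_ones : exists k, mul ones ones = k *: ones.
Proof.
exists (lam * #|T|%:R + eta * (#|T|%:R * #|T|%:R - #|T|%:R) + eta).
apply: coordP => t; rewrite GM_mulE (sum_ones_mull ones).
rewrite (sum_ones_mull (fun s => ones (conjT t s))) csum_conjr -/(csum ones) csum_ones.
by rewrite !ffunE [RHS]mulr1 !mulr1.
Qed.

(** The linear extension of the conjugation by a: the coordinate at t comes from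
the coordinate at t ^ a^-1, which is t ^ a because a is an involution. *)
Definition tau a (v : V) : V := [ffun t => v (conjT t a)].

Lemma csum_tau a v : csum (tau a v) = csum v.
Proof. by rewrite -(csum_conjl v a); apply: eq_bigr => t _; rewrite ffunE. Qed.

(** The terms of GM_mulE depend on conjugation and on sums over T only, both of
which are compatible with conjugation by a. *)
Lemma tauM a (u v : V) : tau a (mul u v) = mul (tau a u) (tau a v).
Proof.
apply: coordP => t; rewrite ffunE !GM_mulE !ffunE; congr (lam * _ + eta * _ + _).
- rewrite (reindex_inj (inv_inj (conjTK a))); apply: eq_bigr => s _.
  by rewrite !ffunE (conjTJ t s a).
- rewrite !csum_tau; congr (_ - _).
  by rewrite (reindex_inj (inv_inj (conjTK a))); apply: eq_bigr => s _; rewrite !ffunE.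
Qed.

Lemma tauZ a c (v : V) : tau a (c *: v) = c *: tau a v.
Proof. by apply: coordP => t; rewrite !ffunE. Qed.

Lemma tauD a (u v : V) : tau a (u + v) = tau a u + tau a v.
Proof. by apply: coordP => t; rewrite !ffunE. Qed.

Lemma tau_ones a : tau a ones = ones.
Proof. by apply: coordP => t; rewrite !ffunE. Qed.

Lemma tauK a : involutive (tau a).
Proof. by move=> v; apply: coordP => t; rewrite !ffunE conjTK. Qed.

(** * Left and right multiplication by an axis *)

Section Axis.
Variable a : I.
Local Notation e := (basis_vec F T (val a)).
(* eigenvector of L_e for the eigenvalue 0 *)
Local Notation z := (ones - eta *: e).

Lemma axisE t : e t = (t == a)%:R :> F.
Proof. by rewrite ffunE val_eqE. Qed.

Lemma tau_axis : tau a e = e.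
Proof.
apply: coordP => t; rewrite ffunE !axisE; congr (_%:R).
by rewrite conjT_eqr.
Qed.

Lemma dot_e (f : I -> F) : \sum_s e s * f s = f a.
Proof. by rewrite -[RHS](sum_deltal f); apply: eq_bigr => s _; rewrite axisE. Qed.

Lemma dotr_e (f : I -> F) : \sum_s f s * e s = f a.
Proof. by rewrite -[RHS]dot_e; apply: eq_bigr => s _; rewrite mulrC. Qed.

Lemma csum_e : csum e = 1.
Proof. by rewrite -(dotr_e (fun=> 1)); apply: eq_bigr => s _; rewrite mul1r. Qed.

Lemma lmulE v t :
  mul e v t = lam * v (conjT t a) + eta * (csum v - v a) + eta * ((t == a)%:R * v a).
Proof.
rewrite GM_mulE (dot_e (fun s => v (conjT t s))) (dot_e v) csum_e mul1r axisE.
by case: eqP => [->|_]; rewrite ?mul0r.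
Qed.

(** Evaluation at conjT a t isolates u t, because s = t is the only s with
a ^ s = a ^ t. *)
Lemma rmulE u t : mul u e (conjT a t) =
  lam * u t + eta * (csum u - u a) + eta * ((t == a)%:R * u a).
Proof.
rewrite GM_mulE dotr_e csum_e mulr1 axisE conjT_eql; congr (lam * _ + _ + eta * _).
  rewrite -[RHS]sum_deltar; apply: eq_bigr => s _; rewrite axisE; congr (_ * _%:R).
  by rewrite (can2_eq (conjTK s) (conjTK s)) (inj_eq (@conjT_injr a)) eq_sym.
by case: eqP => [->|_]; rewrite ?(mul0r, mulr0) // conjTid mulrC.
Qed.

Lemma axis_idem : mul e e = e.
Proof.
apply: coordP => t; have et : e (conjT t a) = e t by rewrite -{2}tau_axis [RHS]ffunE.
rewrite lmulE csum_e et !axisE eqxx /=; ring.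
Qed.

(** On the vectors with v a = 0 and zero coefficient sum, the corrections to
lam * tau in lmulE vanish. *)
Lemma lmul_tau v : v a = 0 -> csum v = 0 -> mul e v = lam *: tau a v.
Proof.
move=> va sv; apply: coordP => t; rewrite lmulE va sv !ffunE.
by rewrite subrr !(mulr0, addr0).
Qed.

Section Spectrum.
Hypotheses (eta_n : eta * (#|T|%:R - 2%:R) = -1) (eta0 : eta != 0).
Hypotheses (lam0 : lam != 0) (lam1 : 1 + lam != 0) (F2 : 2%:R != 0 :> F).

Lemma lmul_ones : mul e ones = eta *: e.
Proof.
apply: coordP => t; rewrite lmulE csum_ones coordZ axisE !onesE.
have -> : eta * (#|T|%:R - 1) = eta * (#|T|%:R - 2%:R) + eta by ring.
by rewrite eta_n; ring.
Qed.

Lemma rmul_ones : mul ones e = eta *: e.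
Proof.
apply: coordP => t'; have [g _ gK] := injF_bij (@conjT_injr a).
rewrite -[t']gK; move: (g t') => {g gK} t.
rewrite rmulE csum_ones coordZ axisE conjT_eql !onesE.
have -> : eta * (#|T|%:R - 1) = eta * (#|T|%:R - 2%:R) + eta by ring.
by rewrite eta_n; ring.
Qed.

(** The first equation is the sum of the coordinates of e * v = mu v other than
the one at a, the second one is the coordinate at a. On the left of
that sum csum v - v a has the coefficient eta * (#|T| - 2) + 1, which vanishes:
this is where the value of eta enters. *)
Lemma eigen_coords mu v : mul e v = mu *: v ->
  [/\ mu * (csum v - v a) = 0,
      (1 - mu) * v a + eta * (csum v - v a) = 0
    & forall t, t != a -> mu * v t = lam * v (conjT t a) + eta * (csum v - v a)].
Proof.
move=> ev; have ct t := esym (congr1 (fun w : V => w t : F) ev).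
have := esym (congr1 csum ev); rewrite csum_mul csumZ csum_e dot_e mul1r => cs.
have ca := ct a; rewrite lmulE ffunE eqxx conjTid in ca.
have {}ca : mu * v a = lam * v a + eta * (csum v - v a) + eta * (1 * v a) by [].
split.
- rewrite mulrBr cs ca.
  transitivity ((eta * (#|T|%:R - 2%:R) + 1) * (csum v - v a)); first by ring.
  by rewrite eta_n addNr mul0r.
- by rewrite mulrBl ca; ring.
move=> t ta; have := ct t; rewrite lmulE ffunE (negPf ta) mul0r mulr0 addr0.
by [].
Qed.

(** Outside a the coordinates satisfy v t = lam * v (t ^ a), hence
v t = lam ^+ 2 * v t, and 1 - lam ^+ 2 = (1 + lam) * eta is nonzero. *)
Lemma eigen1 v : mul e v = 1 *: v -> v = v a *: e.
Proof.
case/eigen_coords; rewrite mul1r => c0 _ ct; apply: coordP => t.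
rewrite [RHS]ffunE axisE /GRing.scale /=; have [->|ta] := eqVneq; first by rewrite mulr1.
have ta' : conjT t a != a by rewrite conjT_eqr.
have := ct t ta; have := ct _ ta'; rewrite conjTK c0 mulr0 !addr0 !mul1r => -> h.
have : (1 + lam) * eta * v t = 0.
  by transitivity (v t - lam * (lam * v t)); [ring | rewrite {1}h subrr].
by move/eqP; rewrite !mulf_eq0 (negPf lam1) (negPf eta0) mulr0 => /eqP.
Qed.

Lemma eigen0 v : mul e v = 0 *: v -> v = (v a / lam) *: z.
Proof.
case/eigen_coords; rewrite subr0 mul1r => _ ca ct; apply: coordP => t.
have cE : v a = - (eta * (csum v - v a)) by apply/eqP; rewrite -addr_eq0 ca.
rewrite coordZ coordD coordN coordZ onesE axisE; have [->|ta] := eqVneq.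
  by rewrite mulr1 divfK.
have ta' : conjT t a != a by rewrite conjT_eqr.
have := ct _ ta'; rewrite conjTK mul0r => h.
rewrite mulr0 subr0 mulr1 cE; apply: (mulfI lam0).
by rewrite [RHS]mulrC divfK //; apply/eqP; rewrite -addr_eq0 -h.
Qed.

Lemma eigen_lam v : mul e v = lam *: v -> [/\ tau a v = v, v a = 0 & csum v = 0].
Proof.
case/eigen_coords; rewrite subKr => /eqP; rewrite mulf_eq0 (negPf lam0) => /eqP c0.
rewrite c0 mulr0 addr0 => /eqP; rewrite mulf_eq0 (negPf eta0) => /eqP va ct.
split=> //; last by move/eqP: c0; rewrite va subr0 => /eqP.
apply: coordP => t; rewrite ffunE; have [->|ta] := eqVneq t a; first by rewrite conjTid.
by apply: (mulfI lam0); rewrite [RHS]ct // addr0.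
Qed.

Lemma eigen_Nlam v : mul e v = - lam *: v -> tau a v = - v.
Proof.
case/eigen_coords; rewrite opprK => /eqP; rewrite mulf_eq0 oppr_eq0 (negPf lam0) => /eqP c0.
rewrite c0 mulr0 addr0 => /eqP; rewrite mulf_eq0 (negPf lam1) => /eqP va ct.
apply: coordP => t; rewrite coordN ffunE; have [->|ta] := eqVneq t a.
  by rewrite conjTid va oppr0.
by apply: (mulfI lam0); rewrite mulrN -mulNr ct // addr0.
Qed.

Lemma anti_coords v : tau a v = - v -> v a = 0 /\ csum v = 0.
Proof.
have eqN0 (x : F) : x = - x -> x = 0.
  by move/eqP; rewrite -addr_eq0 -mulr2n -mulr_natl mulf_eq0 (negPf F2) => /eqP.
move=> tv; split; apply: eqN0.
  by rewrite -[LHS]/(v a : F) -{1}(conjTid a); have /ffunP/(_ a) := tv; rewrite !ffunE.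
by rewrite -{1}(csum_tau a) tv -scaleN1r csumZ mulN1r.
Qed.

Lemma anti_eigen v : tau a v = - v -> mul e v = - lam *: v.
Proof.
move=> tv; have [va sv] := anti_coords tv.
by rewrite lmul_tau // tv scalerN scaleNr.
Qed.

Lemma sym_eigen v : tau a v = v -> v a = 0 -> csum v = 0 -> mul e v = lam *: v.
Proof. by move=> tv va sv; rewrite lmul_tau // tv. Qed.

Lemma lmul_z : mul e z = 0.
Proof. by rewrite GM_mulDr -scaleNr GM_mulZr lmul_ones axis_idem scaleNr subrr. Qed.

Lemma memv_Leigen mu v :
  (v \in passmx.leigenspace (@L_ F (GM_algebra T eta) e) mu) = (mul e v == mu *: v).
Proof.
rewrite memv_leigenspace; congr (_ == _).
exact: (@L_E F (GM_algebra T eta) e v).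
Qed.

Lemma memv_Reigen mu v :
  (v \in passmx.leigenspace (@R_ F (GM_algebra T eta) e) mu) = (mul v e == mu *: v).
Proof.
rewrite memv_leigenspace; congr (_ == _).
exact: (@R_E F (GM_algebra T eta) e v).
Qed.

Local Notation Lsum := (eigensum (@L_ F (GM_algebra T eta) e)).

Lemma memv_Lsum mu Omega v : mu \in Omega -> mul e v = mu *: v -> v \in Lsum Omega.
Proof. by move=> mu_in /eqP; rewrite -memv_Leigen; apply: memv_eigensum. Qed.

Lemma memv_ones_axis c d (Omega : {fset F}) : 0 \in Omega -> 1 \in Omega ->
  c *: ones + d *: e \in Lsum Omega.
Proof.
move=> O0 O1.
have -> : c *: ones + d *: e = c *: z + (c * eta + d) *: e.
  by rewrite scalerBr scalerA scalerDl addrA subrK.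
apply: (@memvD _ (GM_algebra T eta)).
  by apply: (memv_Lsum O0); rewrite GM_mulZr lmul_z scaler0 scale0r.
by apply: (memv_Lsum O1); rewrite GM_mulZr axis_idem scale1r.
Qed.

(** Subtracting a combination of z and e from an invariant vector makes both its
coordinate at a and its coefficient sum vanish, which leaves an eigenvector for
lam. This is possible because #|T| - 1 is invertible: eta * (#|T| - 1) = - lam. *)
Lemma memv_sym (Omega : {fset F}) v : 0 \in Omega -> 1 \in Omega -> lam \in Omega ->
  tau a v = v -> v \in Lsum Omega.
Proof.
move=> O0 O1 Ol tv; have nE : eta * (#|T|%:R - 1) = - lam.
  transitivity (eta * (#|T|%:R - 2%:R) + eta); first by ring.
  by rewrite eta_n opprB addrC.
have n1 : #|T|%:R - 1 != 0 :> F.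
  by apply: contraNneq lam0 => n1; rewrite -oppr_eq0 -nE n1 mulr0.
(* c and d make v - w vanish at a and in coefficient sum *)
pose c := (csum v - v a) / (#|T|%:R - 1); pose d := v a - c.
pose w := c *: ones + d *: e.
have -> : v = (v - w) + w by rewrite subrK.
apply: (@memvD _ (GM_algebra T eta)); last exact: memv_ones_axis.
apply: (memv_Lsum Ol); apply: sym_eigen.
- by rewrite tauD tv -scaleN1r tauZ /w tauD !tauZ tau_axis tau_ones.
- rewrite coordD coordN coordD !coordZ onesE axisE eqxx !mulr1.
  by rewrite addrC [c + _]addrC subrK addNr.
rewrite csumD -scaleN1r csumZ csumD !csumZ csum_ones csum_e.
transitivity (csum v - v a - c * (#|T|%:R - 1)); first by rewrite /d; ring.
by rewrite divfK ?subrr.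
Qed.

(** As 2 is invertible, every vector is the sum of a tau-invariant and a
tau-antiinvariant one. *)
Lemma Lsum_full : Lsum [fset 1; 0; lam; - lam]%fset = fullv.
Proof.
apply/vspaceP=> v; rewrite memvf.
have -> : v = 2%:R^-1 *: (v + tau a v) + 2%:R^-1 *: (v - tau a v).
  by rewrite -scalerDr addrACA subrr addr0 -mulr2n -scaler_nat scalerA mulVf // scale1r.
apply: (@memvD _ (GM_algebra T eta)).
  by apply: memv_sym; rewrite ?inE ?eqxx ?orbT // tauZ tauD tauK addrC.
apply: (@memv_Lsum (- lam)); first by rewrite !inE eqxx !orbT.
apply: anti_eigen; rewrite tauZ tauD -[- tau a v]scaleN1r tauZ tauK !scaleN1r.
by rewrite -scalerN opprB addrC.
Qed.


Lemma mulz_l v : csum v = 0 -> mul z v = eta *: v - eta *: mul e v.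
Proof. by move=> v0; rewrite GM_mulDl -scaleNr GM_mulZl mul_onesl // scaleNr. Qed.

Lemma mulz_r v : csum v = 0 -> mul v z = eta *: v - eta *: mul v e.
Proof. by move=> v0; rewrite GM_mulDr -scaleNr GM_mulZr mul_onesr // scaleNr. Qed.

Lemma mulz_e : mul z e = 0.
Proof. by rewrite GM_mulDl -scaleNr GM_mulZl rmul_ones axis_idem scaleNr subrr. Qed.

Lemma mulz_z Omega : 0 \in Omega -> 1 \in Omega -> mul z z \in Lsum Omega.
Proof.
move=> O0 O1; have -> : mul z z = mul z ones - eta *: mul z e.
  by have := GM_mulDr z ones (- eta *: e); rewrite GM_mulZr !scaleNr.
rewrite mulz_e scaler0 subr0.
rewrite GM_mulDl -scaleNr GM_mulZl lmul_ones scalerA.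
by have [k ->] := mul_ones_ones; apply: memv_ones_axis.
Qed.

Lemma rmul_anti v : tau a v = - v -> mul e (mul v e) = - lam *: mul v e.
Proof.
move=> tv; apply: anti_eigen.
by rewrite tauM tau_axis tv -scaleN1r GM_mulZl scaleN1r.
Qed.

Lemma rmul_sym v : mul e v = lam *: v -> mul e (mul v e) = lam *: mul v e.
Proof.
case/eigen_lam=> tv va sv; apply: sym_eigen.
- by rewrite tauM tau_axis tv.
- by rewrite -{2}(conjTid a) rmulE va sv subrr !mulr0 !addr0.
by rewrite csum_mul sv mul0r dotr_e va subrr !mulr0 !addr0.
Qed.

Lemma fusion1l be u v (Omega : {fset F}) : mul e u = 1 *: u -> mul e v = be *: v ->
  be \in Omega -> mul u v \in Lsum Omega.
Proof.
move=> /eigen1-> ev Obe; apply: (memv_Lsum Obe).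
by rewrite GM_mulZl ev !GM_mulZr ev !scalerA; congr (_ *: _); ring.
Qed.

Lemma fusion1r be u v (Omega : {fset F}) : mul e v = 1 *: v ->
  mul e (mul u e) = be *: mul u e -> be \in Omega -> mul u v \in Lsum Omega.
Proof.
move=> /eigen1-> eu Obe; apply: (memv_Lsum Obe).
by rewrite !GM_mulZr eu !scalerA; congr (_ *: _); ring.
Qed.

Lemma fusion0l be u v (Omega : {fset F}) : mul e u = 0 *: u -> csum v = 0 ->
  mul e v = be *: v -> be \in Omega -> mul u v \in Lsum Omega.
Proof.
move=> /eigen0-> sv ev Obe; apply: (memv_Lsum Obe).
rewrite GM_mulZl mulz_l // ev.
have -> : eta *: v - eta *: (be *: v) = (eta - eta * be) *: v.
  by rewrite scalerBl scalerA.
by rewrite !GM_mulZr ev !scalerA; congr (_ *: _); ring.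
Qed.

Lemma fusion0r be u v (Omega : {fset F}) : mul e v = 0 *: v -> csum u = 0 ->
  mul e u = be *: u -> mul e (mul u e) = be *: mul u e -> be \in Omega ->
  mul u v \in Lsum Omega.
Proof.
move=> /eigen0-> su eu eue Obe; apply: (memv_Lsum Obe).
rewrite GM_mulZr mulz_r // !GM_mulZr -scaleNr GM_mulDr !GM_mulZr eu eue.
by rewrite !scalerDr !scalerA; congr (_ *: _ + _ *: _); ring.
Qed.

Lemma fusion al be u v : uniq [:: 1; 0; lam; - lam] ->
  al \in [fset 1; 0; lam; - lam]%fset -> be \in [fset 1; 0; lam; - lam]%fset ->
  mul e u = al *: u -> mul e v = be *: v ->
  mul u v \in Lsum (GM_op lam (- lam) al be).
Proof.
case/GM_opE=> -[o11 o10 o1l o1n] [o00 o0l o0n] [oll oln onn] oC.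
(* parity under tau settles the rules between lam and - lam *)
have even_uv : tau a (mul u v) = mul u v -> mul u v \in Lsum [fset 1; 0; lam]%fset.
  by apply: memv_sym; rewrite !inE eqxx ?orbT.
have odd_uv : tau a (mul u v) = - mul u v -> mul u v \in Lsum [fset - lam]%fset.
  by move=> /anti_eigen; apply: memv_Lsum; rewrite inE.
have mem0 (Omega : {fset F}) : (0 : V) \in Lsum Omega
  by exact: (@mem0v _ (GM_algebra T eta)).
rewrite !inE -!orbA => /or4P[]/eqP-> /or4P[]/eqP-> eu ev.
- by rewrite o11; apply: fusion1l eu ev _; rewrite inE.
- by rewrite o10 (eigen1 eu) GM_mulZl ev scale0r scaler0.
- by rewrite o1l; apply: fusion1l eu ev _; rewrite inE.
- by rewrite o1n; apply: fusion1l eu ev _; rewrite inE.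
- by rewrite (oC 0 1) o10 (eigen1 ev) (eigen0 eu) GM_mulZl GM_mulZr mulz_e !scaler0.
- rewrite o00 (eigen0 eu) (eigen0 ev) GM_mulZl GM_mulZr.
  by do 2!apply: (@memvZ _ (GM_algebra T eta)); apply: mulz_z; rewrite !inE eqxx ?orbT.
- have [_ _ sv] := eigen_lam ev.
  by rewrite o0l; apply: fusion0l eu sv ev _; rewrite inE.
- have [_ sv] := anti_coords (eigen_Nlam ev).
  by rewrite o0n; apply: fusion0l eu sv ev _; rewrite inE.
- by rewrite (oC lam 1) o1l; apply: fusion1r ev (rmul_sym eu) _; rewrite inE.
- have [_ _ su] := eigen_lam eu.
  by rewrite (oC lam 0) o0l; apply: fusion0r ev su eu (rmul_sym eu) _; rewrite inE.
- have [tu _ _] := eigen_lam eu; have [tv _ _] := eigen_lam ev.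
  by rewrite oll; apply: even_uv; rewrite tauM tu tv.
- have [tu _ _] := eigen_lam eu; have tv := eigen_Nlam ev.
  by rewrite oln; apply: odd_uv; rewrite tauM tu tv -scaleN1r GM_mulZr scaleN1r.
- rewrite (oC (- lam) 1) o1n.
  by apply: fusion1r ev (rmul_anti (eigen_Nlam eu)) _; rewrite inE.
- have [_ su] := anti_coords (eigen_Nlam eu).
  rewrite (oC (- lam) 0) o0n.
  by apply: fusion0r ev su eu (rmul_anti (eigen_Nlam eu)) _; rewrite inE.
- have tu := eigen_Nlam eu; have [tv _ _] := eigen_lam ev.
  rewrite (oC (- lam) lam) oln; apply: odd_uv.
  by rewrite tauM tu tv -scaleN1r GM_mulZl scaleN1r.
- have tu := eigen_Nlam eu; have tv := eigen_Nlam ev.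
  rewrite onn; apply: even_uv; rewrite tauM tu tv -[- u]scaleN1r -[- v]scaleN1r.
  by rewrite GM_mulZl GM_mulZr scalerA mulrNN mulr1 scale1r.
Qed.

Lemma axis_neq0 : e != 0 :> V.
Proof.
apply/eqP=> /(congr1 (fun w : V => w a : F))/eqP.
by rewrite axisE eqxx ffunE oner_eq0.
Qed.

(** Common to L_ e and R_ e: the fixed space is the line through e. *)
Lemma dim_eigen1 (f : 'End(GM_algebra T eta)) :
  (forall v : V, (v \in passmx.leigenspace f 1) = (v == v a *: e)) ->
  \dim (passmx.leigenspace f 1) = 1%N.
Proof.
move=> f1; have -> : passmx.leigenspace f 1 = <[e : GM_algebra T eta]>%VS.
  apply/vspaceP=> v; rewrite f1; apply/eqP/vlineP=> [->|[k ->]]; first by exists (v a).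
  by rewrite coordZ axisE eqxx mulr1.
by rewrite dim_vline (axis_neq0 : (e : GM_algebra T eta) != 0).
Qed.

Lemma left_primitive_axis : left_primitive (e : GM_algebra T eta).
Proof.
apply: dim_eigen1 => v; rewrite memv_Leigen; apply/eqP/eqP=> [/eigen1//|->].
by rewrite GM_mulZr axis_idem scale1r.
Qed.

(** By rmulE, a fixed vector satisfies v (a ^ t) = lam * v t outside a; m
steps of this doubling map lead back to t and multiply v t by lam ^+ m. *)
Lemma right_eigen1 m v : (forall t, iter m (conjT a) t = t) -> lam ^+ m != 1 ->
  mul v e = 1 *: v -> v = v a *: e.
Proof.
move=> itm lm ev; have ct t : mul v e t = v t :> F by rewrite ev coordZ mul1r.
have c0 : csum v - v a = 0.
  have := ct (conjT a a); rewrite rmulE conjTid eqxx => h; apply: (mulfI eta0).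
  rewrite mulr0 -[RHS](subrr (v a : F)) -[X in _ = X - _]h /=; ring.
have vJ t : t != a -> v (conjT a t) = lam * v t :> F.
  by move=> ta; rewrite -ct rmulE c0 (negPf ta) mul0r !mulr0 !addr0.
have iterNa k t : t != a -> iter k (conjT a) t != a.
  by move=> ta; elim: k => // k IH; rewrite iterS conjT_eql.
apply: coordP => t; rewrite coordZ axisE; have [->|ta] := eqVneq; first by rewrite mulr1.
have itv k : v (iter k (conjT a) t) = lam ^+ k * v t :> F.
  by elim: k => [|k IH]; rewrite ?mul1r // iterS vJ ?iterNa // IH exprS mulrA.
have /eqP := itv m; rewrite itm eq_sym -subr_eq0 -{2}[v t]mul1r -mulrBl mulf_eq0 subr_eq0.
by rewrite (negPf lm) mulr0 => /eqP.
Qed.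

Lemma right_primitive_axis m : (forall t, iter m (conjT a) t = t) -> lam ^+ m != 1 ->
  right_primitive (e : GM_algebra T eta).
Proof.
move=> itm lm; apply: dim_eigen1 => v; rewrite memv_Reigen.
apply/eqP/eqP=> [/(right_eigen1 itm lm)//|->].
by rewrite GM_mulZl axis_idem scale1r.
Qed.

Lemma GM_left_axis : uniq [:: 1; 0; lam; - lam] ->
  left_primitive_left_axis (GM_law lam (- lam)) (e : GM_algebra T eta).
Proof.
move=> ud; split; [exact: axis_idem | exact: left_primitive_axis |].
split=> [|al be al_in be_in u v]; first exact: Lsum_full.
by rewrite !memv_Leigen => /eqP eu /eqP ev; apply: fusion.
Qed.

End Spectrum.
End Axis.
End Coordinates.

Theorem proposition2
  (p : nat) (hp : prime p) (hp5 : (5 < p)%N)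
  (gT : finGroupType) (G : {group gT}) (T : {set gT})
  (hGT : GM_group p G T) (h2 : two_generated G T)
  (F : fieldType) (hF : 2%:R != 0 :> F)
  (eta : F) (heta : eta = - (p%:R - 2%:R)^-1)
  (hgood : good_characteristic p eta) :
  let A := GM_algebra T eta in
  let lambda := 1 - eta in
  forall a : gT, a \in T ->
    left_primitive_left_axis (GM_law lambda (- lambda)) (basis_vec F T a : A)
    /\ (forall m : nat, m.-primitive_root (2%:R : 'F_p) -> lambda ^+ m != 1 ->
        left_axis (GM_law lambda (- lambda)) (basis_vec F T a : A)).
Proof.
move=> A lambda a aT; have [TI oT] := GM_invols hGT h2.
have [[T2 TG TJ _ Todd] _] := hGT.
have {}TJ : {in T &, forall s t : gT, (s ^ t)%g \in T}.
  by move=> s t sT tT; apply: TJ => //; apply: (subsetP TG).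
have eta0 : eta != 0.
  apply/eqP=> e0; move: hgood; rewrite /good_characteristic e0 mul0r add0r /=.
  by rewrite inE eqxx.
(* division by zero would give eta = 0 *)
have p2 : p%:R - 2%:R != 0 :> F.
  by apply: contraNneq eta0 => p0; rewrite heta p0 invr0 oppr0.
have eta_n : eta * (#|T|%:R - 2%:R) = -1 by rewrite oT heta mulNr mulVf.
have p_eta : eta * (p%:R - 2%:R) + 1 = 0 by rewrite -oT eta_n addNr.
have NlamE : eta - 1 = - lambda by rewrite /lambda opprB.
move: hgood; rewrite /good_characteristic p_eta NlamE -/lambda /= !inE !negb_or.
case/and4P=> /and3P[n10 n1n n1l] /andP[n0n n0l] nnl _.
have ud : uniq [:: 1; 0; lambda; - lambda].
  by rewrite /= !inE !negb_or n10 n1l n1n n0l n0n eq_sym nnl.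
have lam0 : lambda != 0 by rewrite eq_sym.
have lam1 : 1 + lambda != 0 by rewrite addr_eq0.
pose a' : {x : gT | x \in T} := exist _ a aT.
have ax := GM_left_axis T2 TJ Todd TI a' eta_n eta0 lam0 lam1 hF ud.
split; first exact: ax.
move=> m rt lm; have [idem prim obeys] := ax; split; [exact: idem | | exact: obeys].
split; first exact: prim.
have itm t : iter m (conjT a') t = t := iter_conjT_id T2 TJ Todd TI a' t hp oT rt.
exact: (right_primitive_axis T2 TJ Todd TI eta0 itm lm).
Qed.
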